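(* Let $p$ be an odd prime, let $G$ be a quasi-powerful $p$-group with $d(G)=r$ and let $L\le G$ be a subgroup. Then $d(L)\le \frac{1}{2}r(r+3)$.
   Context: For an odd prime $p$, a finite $p$-group $G$ is powerful if $[G,G]\le G^{p}$, and $G$ is quasi-powerful if $G/Z(G)$ is powerful. $d(X)$ denotes the minimal number of generators of a group $X$. *)

(* Defs.v *)
From mathcomp Require Import all_boot all_fingroup all_solvable.
Set Implicit Arguments. Unset Strict Implicit. Unset Printing Implicit Defensive.
Local Open Scope group_scope.

Definition pow_subgroup (gT : finGroupType) (p : nat) (G : {set gT}) : {set gT} :=
  <<[set x ^+ p | x in G]>>.

(* G is powerful (p odd): [G,G] <= G^p *)
Definition powerful (gT : finGroupType) (p : nat) (G : {set gT}) : bool :=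
  [~: G, G] \subset pow_subgroup p G.

Definition quasi_powerful (gT : finGroupType) (p : nat) (G : {set gT}) : bool :=
  powerful p (G / 'Z(G)).

(* d(G) is the library's 'm(G) (abelian.gen_rank): minimal number of generators *)

(* Main.v *)
(* Suppose Z is central in G and G' <= K := G^p Z; this holds for Z = Z(G) when G
   is quasi-powerful.  Working modulo K^p one finds [K, G] <= K^p, so K satisfies
   the same hypothesis with the same Z, Phi(K) = K^p, and x |-> x^p is a morphism
   from G to K / K^p whose kernel contains K.  Its image on H <= G lies in
   Phi(H) K^p / K^p, and comparing the images and kernels of G and H yields
   |H : Phi(H)| <= |G : G^p| by induction on |G|, through H :&: K <= K.
   On the other hand G / G^p has exponent p and class at most 2, so its order is
   at most p^(r(r+1)/2) when G has r generators.  The resulting bound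
   d(H) <= r(r+1)/2 is stronger than the required one. *)
Require Import Defs.
From mathcomp Require Import all_boot all_fingroup all_solvable.
From mathcomp Require Import ssrAC.
Set Implicit Arguments. Unset Strict Implicit. Unset Printing Implicit Defensive.
Local Open Scope group_scope.

(** When [[~ x, y]] commutes with both elements, the correction term is its power of exponent
    ['C(p, 2)], which an odd prime [p] divides. *)
Lemma expMg_commg_prime (gT : finGroupType) (p : nat) (x y : gT) :
    prime p -> odd p -> commute x [~ x, y] -> commute y [~ x, y] ->
  [~ x, y] ^+ p = 1 -> (y * x) ^+ p = y ^+ p * x ^+ p.
Proof.
move=> p_pr p_odd cx cy xyp1; rewrite expMg_Rmul //.
have /dvdnP[k ->]: p %| 'C(p, 2).
  by rewrite prime_dvd_bin //= odd_prime_gt2.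
by rewrite mulnC expgM xyp1 expg1n mulg1.
Qed.

Lemma expg_Mho1_eq1 (gT : finGroupType) (p : nat) (K : {group gT}) (x : gT) :
  p.-group K -> 'Mho^1(K) = 1 -> x \in K -> x ^+ p = 1.
Proof.
move=> pK K1 Kx; apply/set1gP; rewrite -K1 -(expn1 p).
exact: Mho_p_elt (mem_p_elt pK Kx).
Qed.

(** * The subgroup K = G^p Z and its commutators with G *)

Section MhoCentral.

Variables (gT : finGroupType) (p : nat) (G Z : {group gT}).
Hypotheses (p_pr : prime p) (p_odd : odd p) (pG : p.-group G).
Hypotheses (sZG : Z \subset G) (cGZ : G \subset 'C(Z)).

Let K := ('Mho^1(G) <*> Z)%G.

Lemma Mho1_joing_sub : K \subset G.
Proof. by rewrite join_subG Mho_sub. Qed.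

Lemma Mho1_joing_normal : K <| G.
Proof.
rewrite /normal Mho1_joing_sub normsY ?gFnorm //.
by rewrite cents_norm.
Qed.

Hypothesis sG'K : G^`(1) \subset K.

(** Since [Z] is central, only the commutators [x^p, g] matter. With c = [x, g], such a commutator
    is x^-p (x c)^p. Here [c, x] is central and [c, x]^p = [c^p, x] = 1, so (x c)^p = x^p c^p =
    x^p. *)
Lemma Mho1_joing_cent_step :
    'Mho^1(K) = 1 -> [~: [~: K, G], G] = 1 -> [~: K, G] = 1.
Proof.
move=> K1 KGG1; have pK := pgroupS Mho1_joing_sub pG.
have Kp1 x : x \in K -> x ^+ p = 1 by apply: expg_Mho1_eq1.
apply/commG1P; rewrite join_subG [Z \subset _]centsC cGZ andbT.
rewrite (MhoE 1 pG) gen_subG expn1.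
apply/subsetP=> _ /imsetP[x Gx ->]; apply/centP=> g Gg; apply/commgP.
have Kc: [~ x, g] \in K by rewrite (subsetP sG'K) // mem_commg.
have cKG y : y \in [~: K, G] -> {in G, forall z, commute z y}.
  by move=> KGy z Gz; move/commG1P/centsP: KGG1 => /(_ y KGy z Gz).
have Gc := subsetP Mho1_joing_sub _ Kc.
have KGd: [~ [~ x, g], x] \in [~: K, G] by apply: mem_commg.
rewrite commgEl conjXg conjg_mulR.
have d_p1: [~ [~ x, g], x] ^+ p = 1.
  by rewrite -(commXg p (cKG _ KGd _ Gc)) Kp1 // comm1g.
have -> := expMg_commg_prime p_pr p_odd (cKG _ KGd _ Gc) (cKG _ KGd _ Gx) d_p1.
by rewrite (Kp1 _ Kc) mulg1 mulVg.
Qed.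

End MhoCentral.

Lemma quotient_Mho1_joing (gT : finGroupType) (G Z N : {group gT}) :
    Z \subset G -> N <| G ->
  ('Mho^1(G) <*> Z) / N = 'Mho^1(G / N) <*> (Z / N).
Proof.
move=> sZG /andP[_ nNG].
by rewrite quotientY ?(subset_trans (Mho_sub _ _)) ?(subset_trans sZG) // /quotient morphim_Mho.
Qed.

Lemma quotient_der_Mho1_joing (gT : finGroupType) (G Z N : {group gT}) :
    Z \subset G -> N <| G -> G^`(1) \subset 'Mho^1(G) <*> Z ->
  (G / N)^`(1) \subset 'Mho^1(G / N) <*> (Z / N).
Proof.
move=> sZG nsNG sG'K; have nNG := normal_norm nsNG.
by rewrite -quotient_Mho1_joing // -quotient_der // quotientS.
Qed.

Section Mho1JoingComm.

Variables (gT : finGroupType) (p : nat) (G Z : {group gT}).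
Hypotheses (p_pr : prime p) (p_odd : odd p) (pG : p.-group G).
Hypotheses (sZG : Z \subset G) (cGZ : G \subset 'C(Z)).
Hypothesis sG'K : G^`(1) \subset 'Mho^1(G) <*> Z.

Let K := ('Mho^1(G) <*> Z)%G.

Let sKG : K \subset G. Proof. exact: Mho1_joing_sub. Qed.
Let nsKG : K <| G. Proof. exact: Mho1_joing_normal. Qed.

(* By nilpotency it is enough to show [K, G] <= K^p [K, G, G]. *)
Lemma Mho1_joing_comm : [~: K, G] \subset 'Mho^1(K).
Proof.
pose R := [~: [~: K, G], G]%G; pose N := 'Mho^1(K)%G.
have nKG := normal_norm nsKG.
have nNG : G \subset 'N(N) by rewrite gFnorm_trans.
have sNG : N \subset G by rewrite (subset_trans (Mho_sub _ _)).
have nKKG : G \subset 'N([~: K, G]) by rewrite normsR ?normG.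
have nRG : G \subset 'N(R) by rewrite normsR ?normG.
have sKGK : [~: K, G] \subset K by rewrite commg_subl.
have sKGG : [~: K, G] \subset G by rewrite (subset_trans sKGK).
have sRG : R \subset G by rewrite (subset_trans _ sKGG) // commg_subl.
pose M := (N <*> R)%G.
have nsMG : M <| G by rewrite /normal join_subG sNG sRG normsY.
have nMG := normal_norm nsMG.
have defKM : K / M = 'Mho^1(G / M) <*> (Z / M) by apply: quotient_Mho1_joing.
have sKGM : [~: K, G] \subset M.
  rewrite -quotient_sub1 ?(subset_trans sKGG) // quotientR ?(subset_trans sKG) //.
  rewrite defKM subG1; apply/eqP.
  apply: (Mho1_joing_cent_step p_pr p_odd (quotient_pgroup _ pG)).
  - exact: quotientS.
  - exact: quotient_cents.
  - exact: quotient_der_Mho1_joing.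
  - rewrite /= -defKM -morphim_Mho ?(subset_trans sKG) //.
    by apply: quotientS1; apply: joing_subl.
  rewrite /= -defKM -!quotientR ?(subset_trans sKG) ?(subset_trans sKGG) //.
  by apply: quotientS1; apply: joing_subr.
have nRN : R \subset 'N(N) by apply: subset_trans nNG.
have nKGN : [~: K, G] \subset 'N(N) by apply: subset_trans nNG.
have sKGR : [~: K, G] / N \subset [~: [~: K, G] / N, G / N].
  rewrite -quotientR // quotientSK //.
  by rewrite -norm_joinEr.
(* A nontrivial image of [K, G] in the nilpotent group [G / N] would properly contain its commutator
   with [G / N], against [sKGR]. *)
rewrite -quotient_sub1 // subG1; apply: contraLR isT => ntKG.
have nilG : nilpotent (G / N) by apply: pgroup_nil (quotient_pgroup _ pG).
have := nil_comm_properl nilG (quotientS N sKGG) ntKG (A := G / N).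
rewrite subsetI subxx quotient_norms // => /(_ isT).
by rewrite properE sKGR andbF.
Qed.

(** This lets an induction pass from [G] to [K] with [Z] unchanged. *)
Lemma Mho1_joing_powerful : K^`(1) \subset 'Mho^1(K) <*> Z.
Proof.
by rewrite (subset_trans _ (joing_subl _ _)) // (subset_trans _ Mho1_joing_comm) // commgS.
Qed.

Lemma Phi_Mho1_joing : 'Phi(K) = 'Mho^1(K).
Proof.
rewrite (Phi_joing (pgroupS sKG pG)); apply/joing_idPr.
by rewrite (subset_trans _ Mho1_joing_comm) // commgS.
Qed.

Let N := 'Mho^1(K)%G.

(** Modulo [N], the subgroup [K] is central of exponent dividing p and contains all commutators, so
    [expMg_commg_prime] applies. *)
Lemma expg_Mho1_joing_morphic :
  {in G &, {morph (fun x => coset N x ^+ p) : x y / x * y}}.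
Proof.
have nNG : G \subset 'N(N) by rewrite gFnorm_trans // normal_norm.
have cGK x y : x \in K -> y \in G -> commute (coset N y) (coset N x).
  move=> Kx Gy; have Gx := subsetP sKG x Kx.
  apply/commute_sym/commgP; rewrite -morphR ?(subsetP nNG) //=.
  by rewrite coset_id // (subsetP Mho1_joing_comm) // mem_commg.
move=> x y Gx Gy; rewrite morphM ?(subsetP nNG) //.
have Kyx: [~ y, x] \in K by rewrite (subsetP sG'K) // mem_commg.
have Nyx: [~ coset N y, coset N x] = coset N [~ y, x].
  by rewrite morphR ?(subsetP nNG).
apply: expMg_commg_prime; rewrite ?Nyx //; try exact: cGK.
have Gyx := subsetP sKG _ Kyx.
rewrite -morphX ?(subsetP nNG) //= coset_id //.
by have := Mho_p_elt 1 Kyx (mem_p_elt (pgroupS sKG pG) Kyx); rewrite expn1.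
Qed.

End Mho1JoingComm.

(** * Comparison of |H : Phi(H)| with |G : G^p| *)

(** In the abelian case the two indices are the orders of ['Ohm_1(H)] and ['Ohm_1(G)]. *)
Lemma card_Mho1_Phi_abelian (gT : finGroupType) (p : nat) (G H : {group gT}) :
    p.-group G -> abelian G -> H \subset G ->
  #|H| * #|'Mho^1(G)| <= #|G| * #|'Phi(H)|.
Proof.
move=> pG abG sHG; have abH := abelianS sHG abG.
rewrite (Phi_Mho (pgroupS sHG pG)) // -(mul_card_Ohm_Mho_abelian 1 abG).
rewrite -(mul_card_Ohm_Mho_abelian 1 abH) mulnAC leq_mul2r.
by rewrite leq_mul2r subset_leq_card ?orbT ?OhmS.
Qed.

(** The index inequality is cleared of denominators. Strong induction on |G| passes from (G, H) to
    (K, H :&: K). *)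
Lemma card_Mho1_Phi_quasi_powerful (gT : finGroupType) (p : nat)
    (G Z H : {group gT}) :
    prime p -> odd p -> p.-group G -> Z \subset G -> G \subset 'C(Z) ->
    G^`(1) \subset 'Mho^1(G) <*> Z -> H \subset G ->
  #|H| * #|'Mho^1(G)| <= #|G| * #|'Phi(H)|.
Proof.
move=> p_pr p_odd; have [n] := ubnP #|G|.
elim: n G H => // n IHn G H leGn pG sZG cGZ sG'K sHG.
pose K := ('Mho^1(G) <*> Z)%G; pose N := 'Mho^1(K)%G.
have sKG : K \subset G by apply: Mho1_joing_sub.
have nsKG : K <| G by apply: Mho1_joing_normal.
have sNK : N \subset K by apply: Mho_sub.
have nNG : G \subset 'N(N) by rewrite gFnorm_trans // normal_norm.
have pK := pgroupS sKG pG; have pH := pgroupS sHG pG.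
(* If K = G then Z supplements the Frattini subgroup, hence G = Z is abelian. *)
have [eqKG | neKG] := eqVneq (K : {set gT}) G.
  apply: (card_Mho1_Phi_abelian pG) => //.
  have defG : <<Z>> = G.
    apply: Phi_nongen; apply/eqP; rewrite eqEsubset join_subG Phi_sub sZG /=.
    by rewrite -{1}eqKG genS // setSU // (Phi_joing pG) joing_subr.
  by rewrite /abelian -{2}defG genGid.
have ltKG : #|K| < #|G| by rewrite proper_card // properEneq neKG.
pose A := (H :&: K)%G.
have sAK : A \subset K by apply: subsetIr.
have := IHn K A (leq_trans ltKG leGn) pK.
rewrite joing_subr (subset_trans sKG) // => /(_ isT isT).
move/(_ (Mho1_joing_powerful p_pr p_odd pG sZG cGZ sG'K) sAK) => leA.
pose f := Morphism (expg_Mho1_joing_morphic p_pr p_odd pG sZG cGZ sG'K).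
have sPhi : f @* H \subset 'Phi(H) / N.
  apply/subsetP=> _ /morphimP[x Gx Hx ->] /=.
  rewrite -morphX ?(subsetP nNG) //; apply: mem_quotient.
  rewrite /= (Phi_joing pH) (subsetP (joing_subr _ _)) // -{1}(expn1 p).
  exact: Mho_p_elt (mem_p_elt pH Hx).
have sNMho : N \subset 'Mho^1(G) by apply: MhoS.
have sMhoG : 'Mho^1(G) \subset G by apply: Mho_sub.
(* The image of the morphism [f] is a group, so it suffices that it contains the generating p-th
   powers. *)
have sMho : 'Mho^1(G) / N \subset f @* G.
  suff: <<[set x ^+ (p ^ 1) | x in G]>> / N \subset f @* G.
    by rewrite -(MhoE 1 pG).
  rewrite quotient_gen; last first.
    apply/subsetP=> _ /imsetP[x Gx ->].
    by rewrite (subsetP nNG) ?groupX.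
  rewrite gen_subG expn1; apply/subsetP=> _ /morphimP[_ _ /imsetP[x Gx ->] ->].
  rewrite morphX ?(subsetP nNG) //.
  exact: (mem_morphim f Gx Gx).
have sfK : K \subset 'ker f.
  apply/subsetP=> x Kx; have Gx := subsetP sKG x Kx.
  apply/kerP=> //=; rewrite -morphX ?(subsetP nNG) //= coset_id //.
  by have := Mho_p_elt 1 Kx (mem_p_elt pK Kx); rewrite expn1.
pose M := ('ker f)%G.
have cG : (#|M| * #|f @* G| = #|G|)%N.
  by rewrite card_morphim setIid Lagrange ?subsetIl.
have cH : (#|H :&: M| * #|f @* H| = #|H|)%N.
  by rewrite card_morphim (setIidPr sHG) -indexgI Lagrange ?subsetIl.
have cMho : #|'Mho^1(G)| <= #|f @* G| * #|N|.
  rewrite -(Lagrange sNMho) mulnC leq_mul2r -card_quotient ?(subset_trans sMhoG) //.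
  by rewrite subset_leq_card ?orbT.
have cPhi : #|f @* H| * #|'Phi(A)| <= #|'Phi(H)|.
  (* The part of ['Phi(H)] inside [N] accounts for ['Phi(A)], because ['Phi(K)] is [N]. *)
  have sPA : 'Phi(A) \subset 'Phi(H) :&: N.
    rewrite subsetI (PhiS pH) ?subsetIl //=.
    rewrite -(Phi_Mho1_joing p_pr p_odd pG sZG cGZ sG'K).
    exact: PhiS pK sAK.
  have nNPhi : 'Phi(H) \subset 'N(N).
    by rewrite (subset_trans (Phi_sub H)) // (subset_trans sHG).
  have := subset_leq_card sPhi; rewrite card_quotient // -indexgI => le1.
  rewrite -(Lagrange (subsetIl 'Phi(H) N)) mulnC.
  by rewrite leq_mul // subset_leq_card.
(* The product of [H :&: M] and [K] lies in [M], and their intersection lies in [A]. *)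
have cHM : #|H :&: M| * #|K| <= #|A| * #|M|.
  rewrite (mul_cardG (H :&: M)%G K) mulnC.
  apply: leq_mul; apply: subset_leq_card; first by rewrite /= setSI ?subsetIl.
  by rewrite mul_subG ?subsetIr.
(* This is the common factor in the product of [cHM], [cPhi], [cMho] and [leA]; cancelling it leaves
   the goal. *)
have pos : 0 < #|K| * (#|A| * (#|'Phi(A)| * #|N|)) by rewrite !muln_gt0 !cardG_gt0.
rewrite -(leq_pmul2r pos) -cH -cG.
have := leq_mul (leq_mul cHM cPhi) (leq_mul cMho leA).
rewrite [X in _ -> X <= _](AC (2*(1)*(1*(1*2))) ((1*4)*(2*6)*(3*(5*7)))).
by rewrite [X in _ -> _ <= X](AC (2*1*(1*(1*2))) ((5*1*3)*((2*7)*(4*6)))).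
Qed.

(** * Orders of groups of exponent p and class at most 2 *)

Lemma card_abelem_grank (gT : finGroupType) (p : nat) (E : {group gT}) :
  p.-abelem E -> #|E| = (p ^ 'm(E))%N.
Proof.
move=> abE; rewrite grank_abelian ?(abelem_abelian abE) // (rank_abelem abE).
exact: card_pgroup (abelem_pgroup abE).
Qed.

(** By induction on [s] with n = [size s]: a new generator x costs a factor p for its powers and p^n
    for its commutators with the old ones, and 1 + n + C(n+1, 2) = C(n+2, 2). *)
Lemma card_gen_class2_exponent (gT : finGroupType) (p : nat) (U : {group gT})
    (s : seq gT) :
    prime p -> {in U, forall x, x ^+ p = 1} -> U^`(1) \subset 'C(U) ->
    {subset s <= U} ->
  #|<<[set x in s]>>| <= p ^ 'C((size s).+1, 2).
Proof.
move=> p_pr Up1 cU'U; elim: s => [|x s IHs] sU.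
  have -> : [set x in [::]] = set0 :> {set gT} by apply/setP=> y; rewrite !inE.
  by rewrite gen0 cards1.
have Ux : x \in U by rewrite sU ?mem_head.
have {}sU : {subset s <= U} by move=> y sy; rewrite sU // inE sy orbT.
pose H := <<[set y in s]>>%G.
have sHU : H \subset U by rewrite gen_subG; apply/subsetP=> y; rewrite inE => /sU.
have U'c y : y \in U -> [~ x, y] \in 'C(U).
  by move=> Uy; rewrite (subsetP cU'U) // mem_commg.
have fM : {in U &, {morph commg x : y z / y * z}}.
  move=> y z Uy Uz; rewrite /= commgMJ conjgE (centP (U'c y Uy) z Uz) mulKg.
  by rewrite (centP (U'c y Uy)) ?groupR.
pose f := Morphism fM; pose D := (f @* H)%G.
have sDU : D \subset U.
  by apply/subsetP=> _ /morphimP[y Uy _ ->]; apply: groupR.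
have cDU : D \subset 'C(U).
  by apply/subsetP=> _ /morphimP[y Uy _ ->]; apply: U'c.
(* [D] is elementary abelian and, as an image of [H], has at most [size s] generators. *)
have cD : #|D| <= p ^ size s.
  rewrite (@card_abelem_grank _ p); last first.
    apply/abelemP=> //; split=> [|y /(subsetP sDU)]; last exact: Up1.
    exact: subset_trans cDU (centS sDU).
  rewrite leq_pexp2l ?prime_gt0 // (leq_trans (morphim_grank f sHU)) //.
  by rewrite (leq_trans (grank_min _)) // cardsE card_size.
have nDH : H \subset 'N(D) by rewrite cents_norm // (subset_trans sHU) // centsC.
(* <<x :: s>> is contained in <[x]> * [x, H] * H. *)
have defW : D <*> H = D * H by apply: norm_joinEr.
pose W := (D <*> H)%G.
have sDW : D \subset W by apply: joing_subl.
have sHW : H \subset W by apply: joing_subr.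
have nWx : <[x]> \subset 'N(W).
  rewrite cycle_subG inE; apply/subsetP=> _ /imsetP[w Ww ->].
  move: Ww; rewrite /= defW => /mulsgP[d h Dd Hh ->].
  rewrite conjMg conjgE (centP (subsetP cDU d Dd) x Ux) mulKg conjg_mulR.
  have Uh := subsetP sHU h Hh.
  have Dhx : [~ h, x] \in D by rewrite -invg_comm groupV; apply: (mem_morphim f Uh Hh).
  rewrite -defW.
  exact: groupM (subsetP sDW d Dd) (groupM (subsetP sHW h Hh) (subsetP sDW _ Dhx)).
have sW : <<[set y in x :: s]>> \subset <[x]> * W.
  rewrite -norm_joinEl // gen_subG; apply/subsetP=> y.
  rewrite !inE => /predU1P[-> | sy].
    by rewrite (subsetP (joing_subl _ _)) ?cycle_id.
  rewrite (subsetP (joing_subr _ _)) // (subsetP (joing_subr _ _)) // mem_gen //.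
  by rewrite inE.
apply: leq_trans (subset_leq_card sW) _.
have cardM (A B : {group gT}) : #|A * B| <= #|A| * #|B|.
  by rewrite mul_cardG leq_pmulr ?cardG_gt0.
apply: leq_trans (cardM _ _) _.
have cW : #|W| <= p ^ size s * p ^ 'C((size s).+1, 2).
  by rewrite /= defW (leq_trans (cardM _ _)) // leq_mul // IHs.
have cx : #|<[x]>| <= p.
  by rewrite dvdn_leq ?prime_gt0 // order_dvdn Up1.
apply: leq_trans (leq_mul cx cW) _.
by rewrite mulnA -expnS -expnD leq_pexp2l ?prime_gt0 //= [X in _ <= X]binS bin1 addnC.
Qed.

(** * From orders to numbers of generators *)

(** Burnside basis argument: coset representatives of a minimal generating set of [L / 'Phi(L)]
    generate [L]. *)
Lemma expn_grank_Phi (gT : finGroupType) (p : nat) (L : {group gT}) :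
  prime p -> p.-group L -> p ^ 'm(L) * #|'Phi(L)| <= #|L|.
Proof.
move=> p_pr pL; have abL := Phi_quotient_abelem pL.
have sPL := Phi_sub L; have nPL : L \subset 'N('Phi(L)) by apply: gFnorm.
have [/= Xb defLb oXb] := grank_witness (L / 'Phi(L)).
pose X := (repr \o val : coset_of _ -> gT) @: Xb.
have sXL : X \subset L.
  apply/subsetP=> _ /imsetP[xb Xxb ->].
  rewrite -sub1set -(quotientSGK _ sPL) ?sub1set ?repr_coset_norm //.
  by rewrite quotient_set1 ?repr_coset_norm //= sub1set coset_reprK -defLb mem_gen.
have nPX := subset_trans sXL nPL.
have defL : <<X>> = L.
  apply: Phi_nongen; apply/eqP; rewrite eqEsubset join_subG sPL sXL -joing_idr.
  rewrite -genM_join sub_gen // -quotientSK ?quotient_gen // -defLb genS //.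
  apply/subsetP=> xb Xxb; apply/imsetP; rewrite (setIidPr nPX).
  by exists (repr xb); rewrite /= ?coset_reprK //; apply: imset_f.
have lem : 'm(L) <= 'm(L / 'Phi(L)).
  by rewrite -oXb -{1}defL (leq_trans (grank_min _)) // leq_imset_card.
rewrite -(Lagrange sPL) mulnC leq_mul2l -card_quotient //.
by rewrite (card_abelem_grank abL) leq_pexp2l ?prime_gt0 ?orbT.
Qed.

Lemma quasi_powerful_der_sub (gT : finGroupType) (p : nat) (G : {group gT}) :
    p.-group G -> quasi_powerful p G -> G^`(1) \subset 'Mho^1(G) <*> 'Z(G).
Proof.
move=> pG; have nZG : G \subset 'N('Z(G)) by apply: gFnorm.
have pGZ : p.-group (G / 'Z(G)) by apply: quotient_pgroup.
rewrite /quasi_powerful /powerful /pow_subgroup.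
have := MhoE 1 pGZ; rewrite expn1 => <-.
have nZG' : G^`(1) \subset 'N('Z(G)) := subset_trans (der_sub 1 G) nZG.
rewrite -quotientR // /= -morphim_Mho //= quotientSK // joingC norm_joinEr //.
exact: subset_trans (Mho_sub 1 G) nZG.
Qed.

Theorem theorem6 (gT : finGroupType) (p : nat) (G L : {group gT}) :
  prime p -> odd p -> p.-group G -> quasi_powerful p G -> L \subset G ->
  (2 * 'm(L) <= 'm(G) * ('m(G) + 3))%N.
Proof.
move=> p_pr p_odd pG qpG sLG; pose N := 'Mho^1(G)%G.
have sG'K := quasi_powerful_der_sub pG qpG.
have cGZ : G \subset 'C('Z(G)) by rewrite centsC subsetIr.
have nNG : G \subset 'N(N) by apply: gFnorm.
have leL := card_Mho1_Phi_quasi_powerful p_pr p_odd pG (center_sub G) cGZ sG'K sLG.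
have leG : #|G / N| <= p ^ 'C(('m(G)).+1, 2).
  have [B defB cB] := grank_witness (G / N).
  have Up1 : {in G / N, forall x, x ^+ p = 1}.
    move=> x; apply: expg_Mho1_eq1; first exact: quotient_pgroup.
    by rewrite /= -morphim_Mho //; apply: trivg_quotient.
  (* Modulo [N], the inclusion [sG'K] puts commutators in the image of the centre. *)
  have cU'U : (G / N)^`(1) \subset 'C(G / N).
    rewrite -quotient_der //; apply: subset_trans (quotientS _ sG'K) _.
    rewrite quotientYidl ?(subset_trans (center_sub G)) //.
    by rewrite quotient_cents // subsetIr.
  have := card_gen_class2_exponent (s := enum B) p_pr Up1 cU'U.
  rewrite set_enum defB -cardE cB => leB.
  apply: leq_trans (leB _) _.
    by move=> y; rewrite mem_enum -defB; apply: mem_gen.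
  by rewrite leq_pexp2l ?prime_gt0 // leq_bin2l // ltnS quotient_grank.
have pL := pgroupS sLG pG.
(* Cancelling |Phi(L)| and |N| gives p^d(L) <= |G : N|. *)
have := leq_trans (leq_mul (expn_grank_Phi p_pr pL) (leqnn #|N|)) leL.
rewrite mulnAC leq_pmul2r ?cardG_gt0 // -(Lagrange (Mho_sub 1 G)) mulnC.
rewrite leq_pmul2l ?cardG_gt0 // -card_quotient // => leLG.
have := leq_trans leLG leG; rewrite leq_exp2l ?prime_gt1 // => lemL.
apply: leq_trans (leq_mul (leqnn 2) lemL) _.
(* With r = ['m(G)], 2 C(r+1, 2) = r(r+1) <= r(r+3). *)
by rewrite -(mul_bin_diag _ 1) bin1 mulnC leq_mul2l addn3 ltnS leqW ?orbT.
Qed.
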